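(* Let $n\ge 1$ and let $d_i, d_i'$, $i = 1, \ldots, n$, be positive integers. There exists an open dense semi-algebraic set $\mathscr{U}$ in $\mathbf{P}_{(d_1, \ldots, d_n)} \times \mathbf{P}_{(d_1', \ldots, d_n')}$ such that for every $(f, g)\in\mathscr{U}$ there exists a constant $c > 0$ with $$c\, \mathrm{dist}(x, \mathrm{SOL}(f, g)) \le \|\mathfrak{m}(x)\| \quad \text{for all } x \in \mathbb{R}^n,$$ where $\mathfrak{m}(x):=\min\{f(x),g(x)\}$ (componentwise minimum).
   Context: For positive integers $d_1,\ldots,d_n$, $\mathbf{P}_{(d_1,\ldots,d_n)}$ denotes the set of polynomial maps $f=(f_1,\ldots,f_n)\colon\mathbb{R}^n\to\mathbb{R}^n$ with $\deg f_i\le d_i$ for $i=1,\ldots,n$. It is identified with the Euclidean space $\mathbb{R}^{s_1}\times\cdots\times\mathbb{R}^{s_n}$, where $s_i=\#\{\kappa\in\mathbb{N}^n : |\kappa|\le d_i\}$, by identifying each $f_i=\sum_{|\kappa|\le d_i}u_{i,\kappa}x^\kappa$ with its coefficient vector $(u_{i,\kappa})_{|\kappa|\le d_i}$ (here $|\kappa|=\kappa_1+\cdots+\kappa_n$). Open, dense and semi-algebraic are understood in this Euclidean space. For polynomial maps $f,g\colon\mathbb{R}^n\to\mathbb{R}^n$, $\mathrm{SOL}(f,g):=\{x\in\mathbb{R}^n : f(x)\ge 0,\ g(x)\ge 0,\ \langle f(x),g(x)\rangle=0\}$, with vector inequalities componentwise. $\|\cdot\|$ is the Euclidean norm and $\mathrm{dist}(x,S):=\inf\{\|x-y\|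 : y\in S\}$, where by convention $\mathrm{dist}(x,\emptyset)=1$. *)

(* Defs.v *)
From HB Require Import structures.
From mathcomp Require Import all_boot all_order all_algebra.
From mathcomp Require Import all_classical all_reals all_analysis.
(* Some notations of [mpoly] clash with those of the analysis library. *)
From mathcomp.multinomials Require Import -(notations) mpoly.

Set Implicit Arguments.
Unset Strict Implicit.
Unset Printing Implicit Defensive.
Import Order.TTheory GRing.Theory Num.Theory numFieldNormedType.Exports.
Local Open Scope classical_set_scope.
Local Open Scope ring_scope.

(* Multi-indices kappa in N^n with |kappa| <= d. *)
Definition multiindex (n d : nat) : finType := bmultinom n d.+1.

(* Positions (i, kappa) of the coefficients u_(i,kappa), |kappa| <= d i. *)
Definition coef_index (n : nat) (d : 'I_n -> nat) : finType :=
  {i : 'I_n & multiindex n (d i)}.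

(* P_(d_1,...,d_n), identified with R^(s_1) x ... x R^(s_n): a polynomial map
   is represented by the concatenation of the coefficient vectors of its
   components.  The topology of ['rV[R]_N] is the one of the sup norm, which is
   the Euclidean topology. *)
Definition polymaps (R : realType) (n : nat) (d : 'I_n -> nat) :=
  'rV[R]_#|coef_index d|.

Definition component (R : realType) (n : nat) (d : 'I_n -> nat)
    (u : polymaps R d) (i : 'I_n) : mpoly n R :=
  \sum_(k : multiindex n (d i))
    u 0 (enum_rank (existT (fun j => multiindex n (d j)) i k))
      *: mpolyX R (bmnm k).

Definition peval (R : realType) (n : nat) (p : mpoly n R) (x : 'rV[R]_n) : R :=
  meval (fun j => x 0 j) p.

Definition pmap_eval (R : realType) (n : nat) (d : 'I_n -> nat)
    (u : polymaps R d) (x : 'rV[R]_n) : 'rV[R]_n :=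
  \row_i peval (component u i) x.

(* {x | p(x) = 0 for p in E, 0 < q(x) for q in I}. *)
Definition basic_semialgebraic (R : realType) (N : nat)
    (E I : seq (mpoly N R)) : set 'rV[R]_N :=
  [set x | (forall p, p \in E -> peval p x = 0) /\
           (forall q, q \in I -> 0 < peval q x)].

Definition semialgebraic (R : realType) (N : nat) (A : set 'rV[R]_N) : Prop :=
  exists s : seq (seq (mpoly N R) * seq (mpoly N R)),
    A = [set x | exists2 b, b \in s & basic_semialgebraic b.1 b.2 x].

(* R^N1 x R^N2 is identified with R^(N1 + N2). *)
Definition semialgebraic2 (R : realType) (N1 N2 : nat)
    (A : set ('rV[R]_N1 * 'rV[R]_N2)) : Prop :=
  semialgebraic [set w : 'rV[R]_(N1 + N2) | A (lsubmx w, rsubmx w)].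

Definition inner (R : realType) (n : nat) (x y : 'rV[R]_n) : R :=
  \sum_i x 0 i * y 0 i.

(* The Euclidean norm; [`|x|] on ['rV[R]_n] is the sup norm. *)
Definition enorm (R : realType) (n : nat) (x : 'rV[R]_n) : R :=
  Num.sqrt (\sum_i x 0 i ^+ 2).

Definition dist (R : realType) (n : nat) (x : 'rV[R]_n) (S : set 'rV[R]_n) : R :=
  if `[< S = set0 >] then 1 else inf [set enorm (x - y) | y in S].

Definition SOL (R : realType) (n : nat) (f g : 'rV[R]_n -> 'rV[R]_n) :
    set 'rV[R]_n :=
  [set x | [/\ forall i, 0 <= f x 0 i, forall i, 0 <= g x 0 i
             & inner (f x) (g x) = 0]].

Definition minmap (R : realType) (n : nat) (f g : 'rV[R]_n -> 'rV[R]_n)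
    (x : 'rV[R]_n) : 'rV[R]_n :=
  \row_i Num.min (f x 0 i) (g x 0 i).

(* Main.v *)
Require Import Defs.
From mathcomp Require Import all_boot all_order all_algebra.
From mathcomp Require Import all_classical all_reals all_analysis.
From mathcomp.multinomials Require Import -(notations) mpoly.
From mathcomp Require Import zify ring lra.
Import Order.TTheory GRing.Theory Num.Theory numFieldNormedType.Exports.
Local Open Scope classical_set_scope.
Local Open Scope ring_scope.

(** For a choice b : I_n -> bool let h_b be the square polynomial system whose
    i-th component is f_i if b i and g_i otherwise.  At each point x the vector
    m(x) equals h_b(x), where b records which of f_i(x), g_i(x) is the smaller.
    Hence every lower bound that holds for all the finitely many h_b passes to m.

    Suppose that for every b
    - each real zero a of h_b is nondegenerate, i.e. the Jacobian determinant
      does not vanish at a;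
    - the leading forms of h_b (its parts of degree exactly d_i or d'_i) have no
      common real zero except the origin.
    The first condition gives |h_b(x)| >= c |x - a| near every point a
    ([regular_growth]): at a zero invert the Jacobian matrix, elsewhere h_b
    stays away from 0.  The second gives |h_b(x)| >= c |x| for large x, as all
    degrees are positive ([gensys_growth]).  A zero a of m lies in SOL(f, g), so
    near it dist(x, SOL) is at most a multiple of |x - a|, hence of |m(x)|; near
    a nonzero of m the norm |m| is bounded below; at infinity dist(x, SOL) is at
    most a multiple of |x|.  Compactness of balls assembles these local bounds
    ([global_error_bound]).

    It remains to see that both conditions hold off the zero set of one nonzero
    polynomial P in the coefficients: such a set {P <> 0} is open, dense and
    semi-algebraic.  This avoids Sard's theorem and quantifier elimination.
    The key is [exists_pullback_multiple]: for a polynomial map Phi from R^N to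
    R^N and a nonzero polynomial J in N variables, the N + 1 polynomials
    Phi_1, ..., Phi_N, J are algebraically dependent, and dividing a relation by
    the highest possible power of J produces P <> 0 such that P o Phi is
    divisible by J.  So P vanishes on the image under Phi of {J = 0}.

    To exhibit a set of bad coefficient vectors as such an image, single out in
    each equation one coefficient whose monomial takes the value 1 at the point
    under consideration.  Those n coefficients are determined by the point and
    the remaining coefficients, so the coordinates of the point can be stored in
    their places: Phi recomputes the coefficients ([elimination]).  For degenerate
    zeros the chosen coefficients are the constant terms and J is the Jacobian
    determinant.  For common zeros y of the leading forms with y_j = 1 they are
    the coefficients of the pure powers of x_j; only n - 1 places are needed for
    y, and J is the variable of the place left over. *)

Set Implicit Arguments.
Unset Strict Implicit.
Unset Printing Implicit Defensive.

Local Notation msize p := (@mmeasure _ _ (@mdeg _) p).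
Local Notation "'[mnm' E | i < n ]" := (Multinom [tuple E%N | i < n])
  (at level 0, E at level 99, i name, only parsing).

(** * Algebraic dependence by counting dimensions *)

Lemma msize_mul_le (A : idomainType) N (p q : mpoly N A) a b :
  (msize p <= a.+1)%N -> (msize q <= b.+1)%N -> (msize (p * q) <= (a + b).+1)%N.
Proof.
move=> pa qb; have [->|p0] := eqVneq p 0; first by rewrite mul0r msize0.
have [->|q0] := eqVneq q 0; first by rewrite mulr0 msize0.
by rewrite msizeM //; lia.
Qed.

Lemma msize_exp_le (A : idomainType) N (p : mpoly N A) a k :
  (msize p <= a.+1)%N -> (msize (p ^+ k) <= (a * k).+1)%N.
Proof.
move=> pa; elim: k => [|k IH]; first by rewrite expr0 msize1.
by rewrite exprS mulnS; apply: msize_mul_le.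
Qed.

Lemma msize_prod_le (A : idomainType) N (I : finType) (p : I -> mpoly N A) a :
  (forall i, (msize (p i) <= a.+1)%N) ->
  (msize (\prod_i p i) <= (#|I| * a).+1)%N.
Proof.
move=> pa; rewrite -sum_nat_const.
elim/big_ind2: _ => [|x k y l|i _]; rewrite ?msize1 //.
exact: msize_mul_le.
Qed.

Lemma exists_left_kernel (F : fieldType) m n (M : 'M[F]_(m, n)) :
  (n < m)%N -> exists2 v : 'rV[F]_m, v != 0 & v *m M = 0.
Proof.
move=> nm; have K0 : kermx M != 0.
  by rewrite -mxrank_eq0 mxrank_ker subn_eq0 -ltnNge (leq_ltn_trans (rank_leq_col M)).
exists (nz_row (kermx M)); first by rewrite nz_row_eq0.
by apply/sub_kermxP; exact: nz_row_sub.
Qed.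

(** There are D ^ N.+1 monomials in N + 1 variables with exponents less than D.
    Evaluated at Phi_1, ..., Phi_N, J they have degree at most a constant times
    D, so they lie in a space of dimension at most a constant times D ^ N.  For
    large D a linear relation between them results.  The relation is stored as a
    polynomial in the last variable, with coefficients in the N others. *)
Lemma algebraic_dependence (F : fieldType) N (Phi : 'I_N -> mpoly N F)
    (J : mpoly N F) :
  exists2 P : {poly mpoly N F}, P != 0 &
    (map_poly (mmap (@mpolyC N F) Phi) P).[J] = 0.
Proof.
pose e := (msize J + \sum_i msize (Phi i))%N.
have Je : (msize J <= e.+1)%N by rewrite /e; lia.
have Pe i : (msize (Phi i) <= e.+1)%N.
  by rewrite /e (bigD1 i) //=; lia.
(* D is chosen so that E ^ N < D ^ N * D, with E.-1 bounding the degrees. *)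
pose D := ((N.+1 * e).+1 ^ N).+1.
pose E := (N.+1 * e * D).+1.
pose S := ({ffun 'I_N -> 'I_D} * 'I_D)%type.
pose B := {ffun 'I_N -> 'I_E}.
pose mon k (b : {ffun 'I_N -> 'I_k}) := [mnm (b i : nat) | i < N].
pose G (s : S) := \prod_i Phi i ^+ s.1 i * J ^+ s.2.
have cardSB : (#|{: B}| < #|{: S}|)%N.
  rewrite card_prod !card_ffun !card_ord.
  apply: (@leq_ltn_trans (((N.+1 * e).+1 * D) ^ N)%N).
    have ED : (E <= (N.+1 * e).+1 * D)%N by rewrite /E mulSn /D; lia.
    have leX a b k : (a <= b)%N -> (a ^ k <= b ^ k)%N.
      by case: k => // k; rewrite leq_exp2r.
    exact: leX.
  rewrite expnMn mulnC ltn_pmul2l ?expn_gt0 //.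
pose M := \matrix_(i < #|{: S}|, j < #|{: B}|)
  mcoeff (mon _ (enum_val j)) (G (enum_val i)).
have [v v0 vM] := exists_left_kernel M cardSB.
pose a (s : S) := v 0 (enum_rank s).
have sG (s : S) : (msize (G s) <= E)%N.
  rewrite /E -mulnA mulSn addnC; apply: msize_mul_le.
    rewrite -[N in (N * _)%N]card_ord; apply: msize_prod_le => i.
    apply: (leq_trans (msize_exp_le _ (Pe i))).
    by rewrite ltnS leq_mul2l ltnW ?orbT.
  apply: (leq_trans (msize_exp_le _ Je)).
  by rewrite ltnS leq_mul2l ltnW ?orbT.
have sum0 : \sum_s a s *: G s = 0.
  apply/mpolyP => m; rewrite raddf_sum mcoeff0 /=.
  have [mE|mE] := leqP E (mdeg m).
    apply: big1 => s _; rewrite mcoeffZ memN_msupp_eq0 ?mulr0 //.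
    by apply: msize_mdeg_ge; apply: leq_trans mE.
  have mi i : (m i < E)%N.
    by apply: leq_ltn_trans mE; rewrite mdegE (bigD1 i) //= leq_addr.
  pose b : B := [ffun i => Ordinal (mi i)].
  have bm : mon _ b = m by apply/mnmP => i; rewrite mnmE ffunE.
  move/matrixP/(_ 0 (enum_rank b)): vM; rewrite !mxE => vM0.
  rewrite -[RHS]vM0 [RHS](reindex (@enum_rank S)) /=; last first.
    by exists enum_val => s _; rewrite ?enum_rankK ?enum_valK.
  by apply: eq_bigr => s _; rewrite mcoeffZ mxE !enum_rankK bm.
exists (\sum_s (a s *: mpolyX F (mon _ s.1)) *: 'X^(s.2)); last first.
  rewrite -[RHS]sum0 rmorph_sum /= horner_sum; apply: eq_bigr => s _.
  rewrite map_polyZ map_polyXn hornerZ hornerXn /= mmapZ mmapX /G.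
  rewrite -mul_mpolyC mulrA; congr (_ * _ * _).
  by rewrite /mmap1; apply: eq_bigr => i _; rewrite mnmE.
apply/negP => /eqP P0; case/negP: v0; apply/eqP/rowP => i; rewrite mxE.
rewrite -(enum_valK i); set s := enum_val i.
have := congr1 (fun p : {poly mpoly N F} => mcoeff (mon _ s.1) p`_(s.2)) P0.
rewrite coef0 mcoeff0 => <-; rewrite coef_sum raddf_sum (bigD1 s) //=.
rewrite coefZ coefXn eqxx mulr1 mcoeffZ mcoeffX eqxx mulr1 big1 ?addr0 //.
move=> t ts; rewrite coefZ coefXn; case: eqP => [ts2|_]; last first.
  by rewrite mulr0 mcoeff0.
rewrite mulr1 mcoeffZ mcoeffX; case: eqP => [ts1|_]; last by rewrite mulr0.
case/negP: ts; apply/eqP; rewrite [t]surjective_pairing [s]surjective_pairing.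
congr pair; last by apply: val_inj.
apply/ffunP => j; apply: val_inj.
by move/mnmP/(_ j): ts1; rewrite !mnmE.
Qed.

(** Cancelling J as long as the constant coefficient of P is zero leaves a
    relation whose constant coefficient a is nonzero; that relation says that
    J divides phi a. *)
Lemma root_dvd_coef0 (A B : idomainType) (phi : {rmorphism A -> B})
    (P : {poly A}) (J : B) :
  J != 0 -> P != 0 -> (map_poly phi P).[J] = 0 ->
  exists2 a, a != 0 & exists b, phi a = b * J.
Proof.
move=> J0; elim/poly_ind: P => [|P c IH]; first by rewrite eqxx.
have [->|c0] := eqVneq c 0.
  rewrite addr0 => PX; rewrite rmorphM /= map_polyX hornerM hornerX.
  move/eqP; rewrite mulf_eq0 (negPf J0) orbF => /eqP; apply: IH.
  by apply: contraNneq PX => ->; rewrite mul0r.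
move=> _; rewrite rmorphD rmorphM /= map_polyX map_polyC hornerD hornerM.
rewrite hornerX hornerC /= => /eqP; rewrite addrC addr_eq0 -mulNr => /eqP phic.
by exists c => //; exists (- (map_poly phi P).[J]); exact: phic.
Qed.

(** Consequence used below: P vanishes on the image under Phi of the zero set of
    J, so that this image is contained in a hypersurface. *)
Lemma exists_pullback_multiple (F : fieldType) N (Phi : 'I_N -> mpoly N F)
    (J : mpoly N F) : J != 0 ->
  exists2 P : mpoly N F, P != 0 & exists Q, mmap (@mpolyC N F) Phi P = Q * J.
Proof.
move=> J0; have [P P0 PJ] := algebraic_dependence Phi J.
exact: root_dvd_coef0 J0 P0 PJ.
Qed.

(** * Elimination of the point from a system with generic coefficients *)

Lemma meval_sum (R : comNzRingType) N (v : 'I_N -> R) (I : Type) (r : seq I)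
    (P : pred I) (p : I -> mpoly N R) :
  meval v (\sum_(i <- r | P i) p i) = \sum_(i <- r | P i) meval v (p i).
Proof. exact: raddf_sum. Qed.

Lemma meval_subst (R : comNzRingType) N n (v : 'I_N -> R)
    (sigma : 'I_n -> mpoly N R) (p : mpoly n R) :
  meval v (mmap (@mpolyC N R) sigma p) = meval (fun l => meval v (sigma l)) p.
Proof.
have -> : mmap (@mpolyC N R) sigma p = comp_mpoly [tuple sigma l | l < n] p.
  rewrite /comp_mpoly /mmap; apply: eq_bigr => m _; congr (_ * _).
  by apply: mmap1_eq => l; rewrite tnth_mktuple.
by rewrite comp_mpoly_meval; apply: meval_eq => l; rewrite tnth_mktuple.
Qed.

Lemma peval_prod (R : realType) N (I : finType) (P : I -> mpoly N R) w :
  peval (\prod_i P i) w = \prod_i peval (P i) w.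
Proof. exact: rmorph_prod. Qed.

(** The vector w : 'rV_N lists coefficients; the coefficient of the k-th monomial
    in the i-th equation is the entry of index pos (i, k).  Entries outside the
    image of pos may exist: a selection uses only part of the coefficients of
    a pair of maps. *)
Section Elimination.
Variables (R : realType) (N n : nat) (e : 'I_n -> nat).
Variables (pos : coef_index e -> 'I_N) (pos_inj : injective pos).

Local Notation slot i k := (pos (existT (fun j => multiindex n (e j)) i k)).
Local Notation pvar s := (mpolyX R (mnm1 s)).

Definition gensys (w : 'rV[R]_N) (i : 'I_n) : mpoly n R :=
  \sum_(k : multiindex n (e i)) w 0 (slot i k) *: mpolyX R (bmnm k).

Definition gentop (w : 'rV[R]_N) (i : 'I_n) : mpoly n R :=
  \sum_(k : multiindex n (e i) | mdeg k == e i)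
    w 0 (slot i k) *: mpolyX R (bmnm k).

Lemma slot_inj i k i' k' : slot i k = slot i' k' ->
  existT (fun j => multiindex n (e j)) i k = existT _ i' k'.
Proof. by move/pos_inj. Qed.

Lemma slot_injl i k i' k' : slot i k = slot i' k' -> i = i'.
Proof. by move/slot_inj/(congr1 tag). Qed.

Lemma slot_injr i k k' : slot i k = slot i k' -> k = k'.
Proof. by move/slot_inj/eqP; rewrite eq_Tagged => /eqP. Qed.

Definition fill (kappa : forall i, multiindex n (e i)) (xi : 'I_n -> R)
    (w : 'rV[R]_N) : 'rV[R]_N :=
  \row_s if [pick i | slot i (kappa i) == s] is Some i then xi i else w 0 s.

Lemma fill_slot kappa xi w i : fill kappa xi w 0 (slot i (kappa i)) = xi i.
Proof.
rewrite mxE; case: pickP => [l /eqP/slot_injl -> //|/(_ i)].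
by rewrite eqxx.
Qed.

Lemma fill_other kappa xi w i k : k != kappa i ->
  fill kappa xi w 0 (slot i k) = w 0 (slot i k).
Proof.
move=> kk; rewrite mxE; case: pickP => [l /eqP E|//].
by move: E kk; move/[dup]/slot_injl => -> /slot_injr ->; rewrite eqxx.
Qed.

(** sigma recovers the coordinates of the point from the modified coefficient
    vector z, in which the value xi i has replaced the coefficient of kappa i.
    As the monomial kappa i takes the value 1 at the point, the i-th equation
    can be solved for its coefficient, which is how Phi turns z back into w. *)
Lemma elimination (Q : forall i, pred (multiindex n (e i)))
    (kappa : forall i, multiindex n (e i)) (sigma : 'I_n -> mpoly N R)
    (J : mpoly N R) :
  (forall i, Q i (kappa i)) ->
  (forall i, mmap (@mpolyC N R) sigma (mpolyX R (bmnm (kappa i))) = 1) ->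
  J != 0 ->
  exists2 P : mpoly N R, P != 0 & forall xi w,
    let z := fill kappa xi w in
    peval J z = 0 ->
    (forall i, \sum_(k | Q i k) w 0 (slot i k) *
       meval (fun l => peval (sigma l) z) (mpolyX R (bmnm k)) = 0) ->
    peval P w = 0.
Proof.
move=> Qk sk J0.
pose Phi (s : 'I_N) : mpoly N R :=
  if [pick i | slot i (kappa i) == s] is Some i then
    - \sum_(k | Q i k && (k != kappa i))
        pvar (slot i k) * mmap (@mpolyC N R) sigma (mpolyX R (bmnm k))
  else pvar s.
have [P P0 [T PT]] := exists_pullback_multiple Phi J0.
exists P => // xi w z Jz sys.
have Phiz : (fun s => peval (Phi s) z) =1 w 0.
  move=> s; rewrite /Phi; case: pickP => [i /eqP <-|noslot]; last first.
    rewrite /peval mevalXU mxE; case: pickP => [i|//].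
    by rewrite noslot.
  have := sys i; rewrite (bigD1 (kappa i)) ?Qk //=.
  rewrite -meval_subst sk meval1 mulr1 => /eqP; rewrite addr_eq0 => /eqP ->.
  rewrite /peval mevalN meval_sum; congr (- _).
  apply: eq_bigr => k /andP[_ kk].
  by rewrite mevalM mevalXU meval_subst fill_other.
have := congr1 (fun p => peval p z) PT.
rewrite /peval meval_subst mevalM [X in _ * X]Jz mulr0 => <-.
by apply: meval_eq => s; rewrite -Phiz.
Qed.

Hypothesis e_gt0 : forall i, (0 < e i)%N.

(** Nonvanishing of P rules out degenerate zeros.  The places used are those of
    the constant terms, which do not occur in the Jacobian matrix; overwriting
    them leaves its determinant unchanged. *)
Lemma exists_regular_poly : exists2 P : mpoly N R, P != 0 & forall w x,
  peval P w != 0 -> (forall i, peval (gensys w i) x = 0) ->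
  \det (\matrix_(i, j) peval (mderiv j (gensys w i)) x) != 0.
Proof.
pose kappa i : multiindex n (e i) := bm0.
pose sigma l : mpoly N R := pvar (slot l (kappa l)).
pose JM : 'M[mpoly N R]_n := \matrix_(i, j) \sum_(k : multiindex n (e i))
  pvar (slot i k) * mmap (@mpolyC N R) sigma (mderiv j (mpolyX R (bmnm k))).
have JME z : peval (\det JM) z = \det (\matrix_(i, j)
    \sum_(k : multiindex n (e i)) z 0 (slot i k) *
      meval (fun l => z 0 (slot l (kappa l))) (mderiv j (mpolyX R (bmnm k)))).
  rewrite /peval -det_map_mx; congr (\det _); apply/matrixP => i j.
  rewrite /JM !mxE /= meval_sum; apply: eq_bigr => k _.
  rewrite mevalM mevalXU meval_subst; congr (_ * _).
  by apply: meval_eq => l; rewrite mevalXU.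
have lin_proof i : (mdeg (mnm1 i) < (e i).+1)%N by rewrite mdeg1 ltnS.
pose lin i : multiindex n (e i) := BMultinom (lin_proof i).
have J0 : \det JM != 0.
  (* The system x_i = 0 has the identity as Jacobian matrix. *)
  pose z0 := fill lin (fun=> 1) 0.
  suff J1 : peval (\det JM) z0 = 1.
    by apply: contra_eq_neq J1 => ->; rewrite /peval meval0 eq_sym oner_neq0.
  rewrite JME -[RHS](det1 _ n); congr (\det _); apply/matrixP => i j.
  rewrite !mxE (bigD1 (lin i)) //= fill_slot mul1r big1 ?addr0; last first.
    by move=> k kl; rewrite fill_other // mxE mul0r.
  rewrite mderivX mevalZ mnm1E; case: eqP => [->|_]; last by rewrite mul0r.
  rewrite mul1r; have -> : mnm_sub (mnm1 j) (mnm1 j) = mnm0.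
    by apply/mnmP => l; rewrite mnmBE subnn mnm0E.
  by rewrite mpolyX0 meval1.
have [||P P0 HP] := @elimination (fun i => predT) kappa sigma _ _ _ J0.
- by [].
- by move=> i; rewrite mmapX mmap11.
have x_fill w x l : peval (sigma l) (fill kappa (x 0) w) = x 0 l.
  by rewrite /peval mevalXU fill_slot.
exists P => // w x Pw sysx; apply: contra_neq Pw => detx.
apply: (HP (x 0) w) => [|i]; last first.
  rewrite -[RHS](sysx i) /gensys /peval meval_sum; apply: eq_bigr => k _.
  by rewrite mevalZ; congr (_ * _); apply: meval_eq => l; exact: x_fill.
rewrite JME -[RHS]detx; congr (\det _); apply/matrixP => i j; rewrite !mxE.
rewrite /gensys (raddf_sum (mderiv j)) /peval meval_sum; apply: eq_bigr => k _.
rewrite /= mderivZ mevalZ; have [->|k0] := eqVneq k (kappa i).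
  by rewrite mpolyX0 -mpolyC1 mderivC !meval0 !mulr0.
by rewrite fill_other //; congr (_ * _); apply: meval_eq => l; rewrite fill_slot.
Qed.

Lemma peval_gentopZ w i a x :
  peval (gentop w i) (a *: x) = a ^+ e i * peval (gentop w i) x.
Proof.
rewrite /peval !meval_sum mulr_sumr; apply: eq_bigr => k /eqP ke.
rewrite !mevalZ mulrCA; congr (_ * _); rewrite !mevalX.
have -> : a ^+ e i = \prod_l a ^+ (bmnm k l) by rewrite prodrXr -mdegE ke.
rewrite -big_split /=; apply: eq_bigr => l _.
by rewrite mxE exprMn.
Qed.

(** In the chart y_j = 1 of projective space the pure power of the j-th variable
    takes the value 1.  As y_j is known, the place of its coefficient in the j-th
    equation stores 0 instead of a coordinate, and J is the variable of that
    place. *)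
Lemma exists_chart_poly (j : 'I_n) : exists2 P : mpoly N R, P != 0 &
  forall w (y : 'rV[R]_n), y 0 j = 1 -> (forall i, peval (gentop w i) y = 0) -> peval P w = 0.
Proof.
pose pow i : multinom n := mnm_muln (mnm1 j) (e i).
have pow_deg i : mdeg (pow i) = e i by rewrite mdegMn mdeg1 mul1n.
have pow_proof i : (mdeg (pow i) < (e i).+1)%N by rewrite pow_deg.
pose kappa i : multiindex n (e i) := BMultinom (pow_proof i).
pose sigma l : mpoly N R := if l == j then 1 else pvar (slot l (kappa l)).
have [|||P P0 HP] := @elimination (fun i k => mdeg k == e i) kappa sigma
    (pvar (slot j (kappa j))).
- by move=> i; apply/eqP/pow_deg.
- move=> i; rewrite mmapX /mmap1; apply: big1 => l _.
  rewrite /sigma mulmnE mnm1E eq_sym.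
  by case: eqP => _; rewrite ?expr1n // mul0n expr0.
- by rewrite -msupp_eq0 msuppX.
exists P => // w y yj topy.
apply: (HP (fun l => if l == j then 0 else y 0 l) w) => [|i].
  by rewrite /peval mevalXU fill_slot eqxx.
rewrite -[RHS](topy i) /gentop /peval meval_sum; apply: eq_bigr => k _.
rewrite mevalZ; congr (_ * _); apply: meval_eq => l; rewrite /sigma.
have [->|lj] := eqVneq l j; first by rewrite meval1 yj.
by rewrite mevalXU fill_slot (negPf lj).
Qed.

(** A nonzero common zero, divided by one of its nonzero coordinates, is a common
    zero in a chart because the leading forms are homogeneous. *)
Lemma exists_no_zero_at_infinity_poly : exists2 P : mpoly N R, P != 0 &
  forall w x, peval P w != 0 -> (forall i, peval (gentop w i) x = 0) -> x = 0.
Proof.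
have /choice [P HP] : forall j, exists P : mpoly N R, P != 0 /\ forall w (y : 'rV[R]_n),
    y 0 j = 1 -> (forall i, peval (gentop w i) y = 0) -> peval P w = 0.
  by move=> j; have [P P0 ?] := exists_chart_poly j; exists P.
exists (\prod_j P j); first by apply/prodf_neq0 => j _; case: (HP j).
move=> w x; rewrite peval_prod => /prodf_neq0 Pw topx.
apply/rowP => j; rewrite mxE; apply/eqP; apply: contraTT isT => xj.
apply: contraNN (Pw j isT) => _; case: (HP j) => _ /(_ w ((x 0 j)^-1 *: x)) ->//.
  by rewrite mxE mulVf.
by move=> i; rewrite peval_gentopZ topx mulr0.
Qed.

End Elimination.

(** * Complements of hypersurfaces *)

Lemma digits_inj B N (f g : 'I_N -> nat) :
  (forall i, (f i < B)%N) -> (forall i, (g i < B)%N) ->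
  (\sum_i f i * B ^ i = \sum_i g i * B ^ i)%N -> f =1 g.
Proof.
elim: N f g => [|N IH] f g fB gB; first by move=> _ [].
have shift (h : 'I_N.+1 -> nat) : (\sum_i h i * B ^ i =
    (\sum_(i < N) h (lift ord0 i) * B ^ i) * B + h ord0)%N.
  rewrite big_ord_recl expn0 muln1 addnC big_distrl; congr (_ + _)%N.
  by apply: eq_bigr => i _; rewrite expnSr mulnA.
rewrite !shift => fg.
have fg0 : f ord0 = g ord0.
  by move/(congr1 (modn^~ B)): fg; rewrite !modnMDl !modn_small.
move: fg; rewrite fg0 => /addIn/eqP.
rewrite eqn_pmul2r ?(leq_ltn_trans _ (fB ord0)) // => /eqP/IH fgS i.
have [j ->|->] := unliftP ord0 i; last exact: fg0.
by apply: fgS.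
Qed.

Lemma exists_nonroot_along (R : idomainType) (h : nat -> R) (p : {poly R}) :
  injective h -> p != 0 -> exists k, p.[h k] != 0.
Proof.
move=> h_inj p0; apply: contrapT => /forallNP ph.
have := @max_poly_roots _ p [seq h k | k <- iota 0 (size p)] p0.
rewrite size_map size_iota ltnn map_inj_uniq // iota_uniq.
move=> /(_ _ isT) allroot; suff: false by []; apply: allroot.
by apply/allP => _ /mapP[k _ ->]; apply/rootP/eqP/negPn/negP; exact: ph.
Qed.

(** Kronecker substitution: replacing the i-th variable by t ^ (B ^ i), with B
    larger than all exponents, sends distinct monomials of P to distinct powers
    of t. *)
Lemma exists_meval_neq0 (R : numDomainType) N (P : mpoly N R) :
  P != 0 -> exists v, meval v P != 0.
Proof.
move=> P0; pose B := msize P.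
pose code (m : multinom N) := (\sum_i m i * B ^ i)%N.
have suppB m : m \in msupp P -> forall i, (m i < B)%N.
  move=> /msize_mdeg_lt mB i; apply: leq_ltn_trans mB.
  by rewrite mdegE (bigD1 i) //= leq_addr.
pose p : {poly R} := \sum_(m <- msupp P) mcoeff m P *: 'X^(code m).
have p0 : p != 0.
  have : msupp P != [::] by rewrite msupp_eq0.
  case E : (msupp P) => [//|m0 s] _.
  have m0P : m0 \in msupp P by rewrite E mem_head.
  apply/negP => /eqP/(congr1 (fun q : {poly R} => q`_(code m0))).
  rewrite coef0 coef_sum (bigD1_seq m0) ?msupp_uniq //= coefZ coefXn eqxx mulr1.
  rewrite big_seq_cond big1 ?addr0 => [/eqP|m /andP[mP mm0]].
    by rewrite mcoeff_eq0 m0P.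
  rewrite coefZ coefXn; case: eqP => [/esym cm|_]; last by rewrite mulr0.
  case/negP: mm0; apply/eqP/mnmP => i.
  exact: (digits_inj (suppB _ mP) (suppB _ m0P) cm).
have [k pk] := exists_nonroot_along (@mulrIn R 1 (oner_neq0 R)) p0.
exists (fun i => k%:R ^+ (B ^ i)); rewrite mevalE.
congr (_ != 0): pk; rewrite horner_sum; apply: eq_bigr => m _.
rewrite hornerZ hornerXn; congr (_ * _).
rewrite /code -prodrXr; apply: eq_bigr => i _.
by rewrite -exprM mulnC.
Qed.

Section Real.
Variable R : realType.

Lemma exists_peval_neq0 N (P : mpoly N R) : P != 0 ->
  exists w, peval P w != 0.
Proof.
move=> /exists_meval_neq0 [v vP]; exists (\row_i v i).
by rewrite /peval (meval_eq (v2 := v)) // => i; rewrite mxE.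
Qed.

Lemma peval_line N (P : mpoly N R) (a b : 'rV[R]_N) :
  exists p : {poly R}, forall t, p.[t] = peval P (a + t *: b).
Proof.
exists (mmap (@polyC R) (fun s => (a 0 s)%:P + (b 0 s) *: 'X) P) => t.
rewrite /peval mevalE /mmap horner_sum; apply: eq_bigr => m _.
rewrite hornerCM /mmap1 horner_prod; congr (_ * _); apply: eq_bigr => i _.
by rewrite horner_exp hornerD hornerC hornerZ hornerX !mxE mulrC.
Qed.

Lemma cvg_peval T (F : set_system T) {FF : Filter F} N (P : mpoly N R)
    (v : T -> 'rV[R]_N) (a : 'rV[R]_N) :
  (forall i, v t 0 i @[t --> F] --> a 0 i) ->
  peval P (v t) @[t --> F] --> peval P a.
Proof.
move=> va; rewrite /peval; under eq_cvg do rewrite mevalE.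
rewrite mevalE; apply: cvg_big; first exact: add_continuous.
move=> m _; apply: cvgM; first exact: cvg_cst.
apply: cvg_big; first exact: mul_continuous.
move=> i _; apply: (@cvg_comp _ _ _ (fun t => v t 0 i) (fun x : R => x ^+ m i) _ _ _ (va i)).
exact: exprn_continuous.
Qed.

Lemma continuous_peval N (P : mpoly N R) : continuous (peval P).
Proof. by move=> a; apply: (@cvg_peval _ (nbhs a) _ N P id) => i; exact: coord_continuous. Qed.

Section Nonroots.
Variables (N1 N2 : nat) (P : mpoly (N1 + N2) R).
Hypothesis P0 : P != 0.

Definition nonroots : set ('rV[R]_N1 * 'rV[R]_N2) :=
  [set u | peval P (row_mx u.1 u.2) != 0].

Lemma continuous_peval_pair :
  continuous (fun u : 'rV[R]_N1 * 'rV[R]_N2 => peval P (row_mx u.1 u.2)).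
Proof.
move=> u; apply: (@cvg_peval _ (nbhs u)) => i; rewrite mxE; under eq_cvg do rewrite mxE.
case: (fintype.split i) => j.
  by apply: (@continuous_comp _ _ _ fst (fun w : 'rV[R]_N1 => w 0 j));
    [exact: cvg_fst|exact: coord_continuous].
by apply: (@continuous_comp _ _ _ snd (fun w : 'rV[R]_N2 => w 0 j));
  [exact: cvg_snd|exact: coord_continuous].
Qed.

Lemma open_nonroots : open nonroots.
Proof.
apply: (@open_comp _ _ (fun u : 'rV[R]_N1 * 'rV[R]_N2 => peval P (row_mx u.1 u.2))
  [set x | x != 0]); last exact: open_neq.
by move=> u _; exact: continuous_peval_pair.
Qed.

(** On the line from u to a point where P does not vanish, P restricts to a
    nonzero polynomial in one variable, which has nonroots as close to u as
    desired. *)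
Lemma dense_nonroots : dense nonroots.
Proof.
move=> O [u Ou] oO; have [w Pw] := exists_peval_neq0 P0.
pose v := (lsubmx w, rsubmx w) - u.
pose line (t : R) := u + t *: v.
have line_row t : row_mx (line t).1 (line t).2 =
    row_mx u.1 u.2 + t *: (w - row_mx u.1 u.2).
  by rewrite -{1}[w]hsubmxK opp_row_mx add_row_mx scale_row_mx add_row_mx.
have [p pE] := peval_line P (row_mx u.1 u.2) (w - row_mx u.1 u.2).
have p0 : p != 0.
  apply: contraNneq Pw => p0; have := pE 1.
  by rewrite p0 horner0 scale1r addrC subrK => <-.
have : \forall t \near (0 : R), O (line t).
  have : line t @[t --> (0 : R)] --> line 0.
    by apply: cvgD; [exact: cvg_cst|apply: cvgZr_tmp; exact: cvg_id].
  by apply; apply: open_nbhs_nbhs; split => //; rewrite /line scale0r addr0.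
move=> /nbhs_ballP[d /= d0 dO].
pose h k : R := d / k.+2%:R.
have h_inj : injective h.
  move=> k l /(mulfI (lt0r_neq0 d0))/invr_inj/eqP.
  by rewrite eqr_nat => /eqP[].
have [k pk] := exists_nonroot_along h_inj p0.
exists (line (h k)); split.
  apply: dO; rewrite /ball /= sub0r normrN gtr0_norm ?divr_gt0 //.
  by rewrite ltr_pdivrMr // ltr_pMr // ltr1n.
by rewrite /nonroots /= line_row -pE.
Qed.

Lemma semialgebraic_nonroots : semialgebraic2 nonroots.
Proof.
exists [:: ([::], [:: P]); ([::], [:: - P])].
apply/seteqP; split => w; rewrite /nonroots /= hsubmxK.
  rewrite neq_lt => /orP[] Pw.
    exists ([::], [:: - P]); first by rewrite !inE eqxx orbT.
    by split => //= q; rewrite inE => /eqP ->; rewrite /peval mevalN oppr_gt0.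
  exists ([::], [:: P]); first by rewrite !inE eqxx.
  by split => //= q; rewrite inE => /eqP ->.
case=> b; rewrite !inE => /orP[] /eqP -> /= [_] /(_ _ (mem_head _ _)).
  by move=> /lt0r_neq0.
by rewrite /peval mevalN oppr_gt0 => /ltr0_neq0.
Qed.

End Nonroots.
End Real.

(** * Row vectors with the sup norm *)

Section RowNorms.
Variable R : realType.

Lemma mx_entry_le_norm m n (A : 'M[R]_(m, n)) i j : `|A i j| <= `|A|.
Proof.
rewrite [leRHS]/Num.norm /= mx_normrE.
by apply/bigmax_geP; right => /=; exists (i, j).
Qed.

Lemma row_norm_le n (x : 'rV[R]_n) M :
  0 <= M -> (forall i, `|x 0 i| <= M) -> `|x| <= M.
Proof.
move=> M0 xM; rewrite [leLHS]/Num.norm /= mx_normrE.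
by apply/bigmax_leP; split => // -[i j] _ /=; rewrite ord1.
Qed.

Lemma row_norm_attained n (x : 'rV[R]_n) : x != 0 -> exists i, `|x| = `|x 0 i|.
Proof.
rewrite -normr_eq0 => /mx_norm_neq0[[i j] /= xE].
by exists j; rewrite [LHS]xE ord1.
Qed.

Lemma norm_mulmx_le n p (v : 'rV[R]_n) (B : 'M[R]_(n, p)) :
  `|v *m B| <= n%:R * `|v| * `|B|.
Proof.
apply: row_norm_le => [|j]; first by rewrite !mulr_ge0.
rewrite mxE (le_trans (ler_norm_sum _ _ _)) //.
apply: (@le_trans _ _ (\sum_(k < n) `|v| * `|B|)).
  by apply: ler_sum => k _; rewrite normrM ler_pM // mx_entry_le_norm.
by rewrite sumr_const card_ord -[leLHS]mulr_natl mulrA.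
Qed.

Lemma norm_le_enorm n (x : 'rV[R]_n) : `|x| <= enorm x.
Proof.
apply: row_norm_le => [|i]; first exact: sqrtr_ge0.
rewrite -sqrtr_sqr ler_sqrt; last by apply: sumr_ge0 => k _; exact: sqr_ge0.
by rewrite (bigD1 i) //= lerDl sumr_ge0 // => k _; exact: sqr_ge0.
Qed.

Lemma enorm_le_norm n (x : 'rV[R]_n) : enorm x <= n%:R * `|x|.
Proof.
rewrite -[leRHS]ger0_norm ?mulr_ge0 // -sqrtr_sqr ler_sqrt ?sqr_ge0 //.
apply: (@le_trans _ _ (n%:R * `|x| ^+ 2)).
  rewrite mulr_natl -[n in _ *+ n]card_ord -sumr_const; apply: ler_sum => i _.
  by rewrite -real_normK ?num_real // lerXn2r ?nnegrE // mx_entry_le_norm.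
rewrite exprMn ler_wpM2r ?sqr_ge0 // -natrX ler_nat.
by case: (n) => // k; rewrite -mulnn leq_pmulr.
Qed.

Lemma cvg_row T (F : set_system T) {FF : Filter F} n
    (v : T -> 'rV[R]_n) (a : 'rV[R]_n) :
  (forall i, v t 0 i @[t --> F] --> a 0 i) -> v t @[t --> F] --> a.
Proof.
move=> va; apply/cvgrPdist_le => eps eps0.
have /filter_forall : forall i, \forall t \near F, `|a 0 i - v t 0 i| <= eps.
  by move=> i; move/cvgrPdist_le: (va i); apply.
apply: filterS => t vt; apply: row_norm_le => [|i]; first exact: ltW.
by rewrite !mxE; exact: vt.
Qed.

Lemma compact_closed_norm_ball n (r : R) : compact [set x : 'rV[R]_n | `|x| <= r].
Proof.
apply: bounded_closed_compact.
  exists r; split; first exact: num_real.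
  by move=> M rM x /= xr; apply: le_trans xr (ltW rM).
apply: (@preimage_closed _ _ (fun x : 'rV[R]_n => `|x|) [set y | y <= r]).
  by move=> x _; exact: norm_continuous.
exact: closed_le.
Qed.

Lemma compact_norm_sphere n : compact [set x : 'rV[R]_n | `|x| = 1].
Proof.
apply: (subclosed_compact _ (@compact_closed_norm_ball n 1) _).
  apply: (@preimage_closed _ _ (fun x : 'rV[R]_n => `|x|) [set y | y = 1]).
    by move=> x _; exact: norm_continuous.
  exact: closed_eq.
by move=> x /= ->.
Qed.

End RowNorms.

(** * Growth near a point *)

(** Instance search recognises nbhs a as a filter for the topology of row vectors,
    but not when it is elaborated through the filtered structure of matrices. *)
#[local] Instance nbhs_row_filter (R : realType) n (a : 'rV[R]_n) :
  ProperFilter (nbhs a).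
Proof. exact: nbhs_pfilter. Qed.

Section LocalGrowth.
Variables (R : realType) (n : nat).
Implicit Types (p q : mpoly n R) (a x : 'rV[R]_n).

(** Hadamard's lemma in a weak form that is stable under products: p(x) - p(a) is a
    combination of the x_j - a_j, with coefficients tending to the partial
    derivatives of p at a. *)
Definition hadamard p a := exists q : 'I_n -> 'rV[R]_n -> R,
  (forall x, peval p x - peval p a = \sum_j (x 0 j - a 0 j) * q j x) /\
  (forall j, q j x @[x --> a] --> peval (mderiv j p) a).

Lemma hadamardC c a : hadamard (mpolyC n c) a.
Proof.
exists (fun _ _ => 0); split=> [x|j].
  by rewrite /peval !mevalC subrr big1 // => j _; rewrite mulr0.
by rewrite mderivC /peval meval0; exact: cvg_cst.
Qed.

Lemma hadamardX i a : hadamard (mpolyX R (mnm1 i)) a.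
Proof.
exists (fun j _ => (i == j)%:R); split=> [x|j].
  rewrite /peval !mevalXU (bigD1 i) //= eqxx mulr1 big1 ?addr0 // => j ji.
  by rewrite eq_sym (negPf ji) mulr0.
rewrite mderivX /peval mevalZ mnm1E.
case: eqP => [->|_]; last by rewrite mul0r; exact: cvg_cst.
have -> : mnm_sub (mnm1 j) (mnm1 j) = mnm0.
  by apply/mnmP => l; rewrite mnmBE subnn mnm0E.
by rewrite mpolyX0 meval1 mulr1; exact: cvg_cst.
Qed.

Lemma hadamardD p q a : hadamard p a -> hadamard q a -> hadamard (p + q) a.
Proof.
move=> [s [sE sa]] [t [tE ta]]; exists (fun j x => s j x + t j x); split=> [x|j].
  rewrite /peval !mevalD opprD addrACA [X in X + _]sE [X in _ + X]tE -big_split.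
  by apply: eq_bigr => j _; rewrite mulrDr.
by rewrite mderivD /peval mevalD; apply: cvgD.
Qed.

Lemma hadamardM p q a : hadamard p a -> hadamard q a -> hadamard (p * q) a.
Proof.
move=> [s [sE sa]] [t [tE ta]].
exists (fun j x => s j x * peval q x + peval p a * t j x); split=> [x|j].
  rewrite /peval !mevalM -!/(peval _ _).
  have -> : peval p x * peval q x - peval p a * peval q a =
      (peval p x - peval p a) * peval q x + peval p a * (peval q x - peval q a).
    by ring.
  rewrite sE tE mulr_suml mulr_sumr -big_split.
  by apply: eq_bigr => j _ /=; ring.
rewrite mderivM /peval mevalD !mevalM; apply: cvgD; apply: cvgM => //.
- exact: continuous_peval.
- exact: cvg_cst.
Qed.

Lemma hadamardP p a : hadamard p a.
Proof.
rewrite (mpolyE p); elim/big_ind: _ => [||m _].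
- by rewrite -(mpolyC0 n); exact: hadamardC.
- by move=> q r; exact: hadamardD.
rewrite -mul_mpolyC; apply: hadamardM; first exact: hadamardC.
rewrite mpolyXE_id; elim/big_ind: _ => [||i _].
- by rewrite -mpolyC1; exact: hadamardC.
- by move=> q r; exact: hadamardM.
elim: (m i) => [|k IH]; first by rewrite expr0 -mpolyC1; exact: hadamardC.
by rewrite exprS; apply: hadamardM => //; exact: hadamardX.
Qed.

(** With A the Jacobian matrix, h(x) = (A + E(x)) (x - a) where E(x) tends to 0.
    Applying the inverse of A bounds |x - a| by K |h(x)| + K |E(x) (x - a)|, and
    near a the last term is at most |x - a| / 2. *)
Lemma regular_zero_growth (h : 'I_n -> mpoly n R) a :
  (forall i, peval (h i) a = 0) ->
  \det (\matrix_(i, j) peval (mderiv j (h i)) a) != 0 ->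
  exists2 c : R, 0 < c &
    \forall x \near a, c * `|x - a| <= `|\row_i peval (h i) x|.
Proof.
set A := \matrix_(i, j) _ => ha0 detA.
have /choice [q qP] : forall i, exists q : 'I_n -> 'rV[R]_n -> R,
  (forall x, peval (h i) x - peval (h i) a = \sum_j (x 0 j - a 0 j) * q j x) /\
  (forall j, q j x @[x --> a] --> peval (mderiv j (h i)) a).
  by move=> i; exact: hadamardP.
pose B := invmx A^T.
have AB : A^T *m B = 1%:M by rewrite mulmxV // unitmx_tr unitmxE unitfE.
pose K := n%:R * `|B| + 1.
have K0 : 0 < K by rewrite ltr_wpDl // mulr_ge0.
pose eps := (2 * K * n.+1%:R)^-1.
have eps0 : 0 < eps by rewrite invr_gt0 !mulr_gt0.
exists (2 * K)^-1; first by rewrite invr_gt0 mulr_gt0.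
have /filter_forall : forall ij : 'I_n * 'I_n,
    \forall x \near a, `|A ij.1 ij.2 - q ij.1 ij.2 x| <= eps.
  case=> i j; have [_ /(_ j)] := qP i.
  by move=> /cvgrPdist_le; rewrite /A mxE; apply.
apply: filterS => x qx.
pose E : 'M[R]_n := \matrix_(j, i) (q i j x - A i j).
have hE : \row_i peval (h i) x = (x - a) *m A^T + (x - a) *m E.
  apply/rowP => i; rewrite -mulmxDr !mxE -[LHS](subrK (peval (h i) a)) {2}ha0 addr0.
  have [-> _] := qP i; apply: eq_bigr => j _.
  have -> : (A^T + E) j i = q i j x.
    by rewrite mxE [A^T _ _]mxE [E _ _]mxE addrC subrK.
  by rewrite !mxE.
have Eeps : `|(x - a) *m E| <= (2 * K)^-1 * `|x - a|.
  apply: row_norm_le => [|i]; first by rewrite mulr_ge0 // invr_ge0 mulr_ge0 // ltW.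
  rewrite mxE (le_trans (ler_norm_sum _ _ _)) //.
  apply: (@le_trans _ _ (\sum_(k < n) `|x - a| * eps)).
    apply: ler_sum => k _; rewrite normrM ler_pM // ?mx_entry_le_norm //.
    by rewrite !mxE distrC; have := qx (i, k); rewrite /A mxE.
  rewrite sumr_const card_ord -[leLHS]mulr_natl mulrCA mulrC ler_wpM2r //.
  rewrite /eps invfM mulrCA -[leRHS]mulr1 ler_wpM2l ?invr_ge0 ?mulr_ge0 ?ltW //.
  by rewrite ltr_pdivrMr // mul1r ltr_nat.
have xaE : x - a = (\row_i peval (h i) x - (x - a) *m E) *m B.
  by rewrite hE addrK -mulmxA AB mulmx1.
have : `|x - a| <= K * `|\row_i peval (h i) x - (x - a) *m E|.
  rewrite {1}xaE (le_trans (norm_mulmx_le _ _)) // mulrAC ler_wpM2r //.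
  by rewrite lerDl.
move=> /le_trans/(_ (ler_wpM2l (ltW K0) (ler_normB _ _))).
rewrite mulrDr => xa_le; rewrite mulrC ler_pdivrMr ?mulr_gt0 //.
have : K * `|(x - a) *m E| <= 2^-1 * `|x - a|.
  apply: le_trans (ler_wpM2l (ltW K0) Eeps) _.
  by rewrite mulrA invfM [K * _]mulrCA mulfV ?gt_eqF // mulr1.
lra.
Qed.

Lemma regular_growth (h : 'I_n -> mpoly n R) :
  (forall x, (forall i, peval (h i) x = 0) ->
    \det (\matrix_(i, j) peval (mderiv j (h i)) x) != 0) ->
  forall a, exists2 c : R, 0 < c &
    \forall x \near a, c * `|x - a| <= `|\row_i peval (h i) x|.
Proof.
move=> reg a; have [ha0|] := pselect (forall i, peval (h i) a = 0).
  by apply: regular_zero_growth => //; exact: reg.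
move=> /existsNP[i /eqP hia].
exists (`|peval (h i) a| / 2); first by rewrite divr_gt0 // normr_gt0.
have half : `|peval (h i) a| / 2 < `|peval (h i) a|.
  by have := hia; rewrite -normr_gt0; lra.
have near_le1 : \forall x \near a, `|a - x| <= 1.
  by apply/nbhs_ballP; exists 1 => //= y; rewrite -ball_normE => /ltW.
have near_half : \forall x \near a, `|peval (h i) a| / 2 <= `|peval (h i) x|.
  have : peval (h i) x @[x --> a] --> peval (h i) a by exact: continuous_peval.
  by move=> /cvgr_norm_ge; apply.
apply: filterS2 near_le1 near_half => x xa hx; apply: (@le_trans _ _ (`|peval (h i) a| / 2)).
  by rewrite ler_piMr ?divr_ge0 // distrC.
apply: le_trans hx _.
by have := mx_entry_le_norm (\row_i peval (h i) x) 0 i; rewrite mxE.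
Qed.

End LocalGrowth.

(** * Growth at infinity *)

Section Coercivity.
Variables (R : realType) (N n : nat) (e : 'I_n -> nat).
Variables (pos : coef_index e -> 'I_N) (w : 'rV[R]_N).
Hypothesis e_gt0 : forall i, (0 < e i)%N.

Lemma meval_monomial_le (k : multinom n) (x : 'rV[R]_n) E :
  1 <= `|x| -> (mdeg k <= E)%N -> `|meval (x 0) (mpolyX R k)| <= `|x| ^+ E.
Proof.
move=> x1 kE; rewrite mevalX normr_prod.
apply: (@le_trans _ _ (\prod_(i < n) `|x| ^+ k i)).
  apply: ler_prod => i _; rewrite normr_ge0 normrX lerXn2r ?nnegrE //.
  exact: mx_entry_le_norm.
by rewrite prodrXr -mdegE ler_weXn2l.
Qed.

Lemma gensys_near_top : exists2 C : R, 0 <= C & forall i (x : 'rV[R]_n),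
  1 <= `|x| ->
  `|peval (gensys pos w i) x - peval (gentop pos w i) x| <= C * `|x| ^+ (e i).-1.
Proof.
pose W i (k : multiindex n (e i)) :=
  w 0 (pos (existT (fun j => multiindex n (e j)) i k)).
exists (\sum_i \sum_k `|W i k|).
  by apply: sumr_ge0 => i _; apply: sumr_ge0.
move=> i x x1; rewrite /peval !meval_sum.
rewrite (bigID (fun k : multiindex n (e i) => mdeg k == e i)) /= addrAC subrr.
rewrite add0r (le_trans (ler_norm_sum _ _ _)) //.
apply: (@le_trans _ _ (\sum_k `|W i k| * `|x| ^+ (e i).-1)).
  rewrite [leRHS](bigID (fun k : multiindex n (e i) => mdeg k == e i)) /=.
  apply: ler_wpDl; first by apply: sumr_ge0 => k _; rewrite mulr_ge0 ?exprn_ge0.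
  apply: ler_sum => k ke; rewrite mevalZ normrM ler_wpM2l //.
  apply: meval_monomial_le => //.
  by have := bmdeg k; have := e_gt0 i; move: ke; lia.
rewrite -mulr_suml ler_wpM2r ?exprn_ge0 //.
by rewrite [leRHS](bigD1 i) //= lerDl sumr_ge0 // => j _; apply: sumr_ge0.
Qed.

(** The leading forms are bounded below by eta > 0 on the unit sphere, hence one of
    them is at least eta |x| ^ e_i at x, while the terms of lower degree are at
    most C |x| ^ (e_i - 1). *)
Lemma gensys_growth :
  (forall x : 'rV[R]_n, (forall i, peval (gentop pos w i) x = 0) -> x = 0) ->
  exists2 c : R, 0 < c & exists r : R, forall x : 'rV[R]_n, r <= `|x| ->
    c * `|x| <= `|\row_i peval (gensys pos w i) x|.
Proof.
move=> top_nz.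
pose top x : 'rV[R]_n := \row_i peval (gentop pos w i) x.
have normalize (x : 'rV[R]_n) : 1 <= `|x| -> `| `|x|^-1 *: x | = 1.
  move=> x1; have x0 : 0 < `|x| by apply: lt_le_trans x1.
  by rewrite normrZ normfV normr_id mulVf // gt_eqF.
have [[x0 x01]|noS] := pselect (exists x : 'rV[R]_n, `|x| = 1); last first.
  exists 1 => //; exists 1 => x x1; case: noS.
  by exists (`|x|^-1 *: x); exact: normalize.
have top_cont : continuous (fun x => `|top x|).
  move=> x; have top_row : top y @[y --> x] --> top x.
    apply: cvg_row => i; rewrite mxE.
    by under eq_cvg do rewrite mxE; exact: continuous_peval.
  exact: (cvg_norm top_row).
have [th thS th_min] : exists2 th, th \in [set x : 'rV[R]_n | `|x| = 1] &
    forall x, x \in [set x : 'rV[R]_n | `|x| = 1] -> `|top th| <= `|top x|.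
  apply: compact_EVT_min; first by exists x0.
    exact: compact_norm_sphere.
  exact: continuous_subspaceT.
have eta0 : 0 < `|top th|.
  rewrite normr_gt0; apply/negP => /eqP top0.
  move: thS; rewrite inE /= (top_nz th) => [|i]; last first.
    by move/rowP/(_ i): top0; rewrite !mxE.
  by rewrite normr0 => /eqP; rewrite eq_sym oner_eq0.
set eta := `|top th| in eta0 th_min.
have [C C0 CP] := gensys_near_top.
exists (eta / 2); first by rewrite divr_gt0.
exists (Num.max 1 (2 * C / eta)) => x; rewrite ge_max => /andP[x1 xC].
have rho0 : 0 < `|x| by apply: lt_le_trans x1.
have := th_min (`|x|^-1 *: x); rewrite inE /= normalize // => /(_ erefl) eta_le.
have [|i topi] := @row_norm_attained _ _ (top (`|x|^-1 *: x)).
  by rewrite -normr_gt0 (lt_le_trans eta0).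
have topx : peval (gentop pos w i) x =
    `|x| ^+ e i * peval (gentop pos w i) (`|x|^-1 *: x).
  by rewrite -peval_gentopZ scalerA mulfV ?scale1r // gt_eqF.
have top_ge : `|x| ^+ e i * eta <= `|peval (gentop pos w i) x|.
  rewrite topx normrM ger0_norm ?exprn_ge0 // ler_wpM2l ?exprn_ge0 //.
  by rewrite (le_trans eta_le) // topi mxE.
apply: le_trans (mx_entry_le_norm _ 0 i); rewrite mxE.
have := CP i x x1; rewrite distrC => /(le_trans (lerB_dist _ _)) near_top.
have rhoE : `|x| ^+ e i = `|x| ^+ (e i).-1 * `|x| by rewrite -exprSr prednK.
have pow1 : 1 <= `|x| ^+ (e i).-1 by rewrite exprn_ege1.
move: xC; rewrite ler_pdivrMr // => xC.
rewrite rhoE in top_ge; nra.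
Qed.

End Coercivity.

(** * The selections from a pair of polynomial maps *)

Section Selections.
Variables (R : realType) (n : nat) (d d' : 'I_n -> nat).
Implicit Types b : {ffun 'I_n -> bool}.

Definition sel_deg b (i : 'I_n) := if b i then d i else d' i.

(** The dependent conditional transports the multi-index from the degree
    sel_deg b i to d i or d' i according to b i. *)
Definition sel_pos b (s : coef_index (sel_deg b)) :
    'I_(#|coef_index d| + #|coef_index d'|) :=
  let i := tag s in
  (if b i as c
    return multiindex n (if c then d i else d' i) ->
      'I_(#|coef_index d| + #|coef_index d'|)
   then fun k => lshift _ (enum_rank (existT (fun j => multiindex n (d j)) i k))
   else fun k => rshift _ (enum_rank (existT (fun j => multiindex n (d' j)) i k)))
  (tagged s).

Lemma sel_pos_inj b : injective (@sel_pos b).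
Proof.
move=> [i k] [j l] E; have ij : i = j.
  move: k l E; rewrite /sel_pos /sel_deg /=.
  case: (b i); case: (b j) => k l.
  - by move/lshift_inj/enum_rank_inj/(congr1 tag).
  - by move/eqP; rewrite eq_lrshift.
  - by move/eqP; rewrite eq_rlshift.
  - by move/rshift_inj/enum_rank_inj/(congr1 tag).
subst j; congr (existT _ i _); move: k l E; rewrite /sel_pos /sel_deg /=.
case: (b i) => k l.
  by move/lshift_inj/enum_rank_inj/eqP; rewrite eq_Tagged => /eqP.
by move/rshift_inj/enum_rank_inj/eqP; rewrite eq_Tagged => /eqP.
Qed.

Lemma gensys_sel b (u : polymaps R d * polymaps R d') i :
  gensys (@sel_pos b) (row_mx u.1 u.2) i =
  if b i then component u.1 i else component u.2 i.
Proof.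
rewrite /gensys /component /sel_pos /sel_deg /=.
by case: (b i); apply: eq_bigr => k _; rewrite ?row_mxEl ?row_mxEr.
Qed.

Lemma exists_generic_poly :
  (forall i, 0 < d i)%N -> (forall i, 0 < d' i)%N ->
  exists2 P : mpoly (#|coef_index d| + #|coef_index d'|) R, P != 0 &
  forall w, peval P w != 0 -> forall b,
    (forall x, (forall i, peval (gensys (@sel_pos b) w i) x = 0) ->
      \det (\matrix_(i, j) peval (mderiv j (gensys (@sel_pos b) w i)) x) != 0) /\
    (forall x, (forall i, peval (gentop (@sel_pos b) w i) x = 0) -> x = 0).
Proof.
move=> d0 d'0; have e0 b i : (0 < sel_deg b i)%N by rewrite /sel_deg; case: (b i).
have /choice [P HP] : forall b, exists P : mpoly _ R, P != 0 /\
    forall w, peval P w != 0 ->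
    (forall x, (forall i, peval (gensys (@sel_pos b) w i) x = 0) ->
      \det (\matrix_(i, j) peval (mderiv j (gensys (@sel_pos b) w i)) x) != 0) /\
    (forall x, (forall i, peval (gentop (@sel_pos b) w i) x = 0) -> x = 0).
  move=> b.
  have [P P0 HP] := exists_regular_poly R (@sel_pos_inj b) (e0 b).
  have [Q Q0 HQ] := exists_no_zero_at_infinity_poly R (@sel_pos_inj b).
  exists (P * Q); split=> [|w]; first by rewrite mulf_neq0.
  rewrite /peval mevalM mulf_eq0 negb_or => /andP[Pw Qw].
  by split=> x; [exact: HP | exact: HQ].
exists (\prod_b P b); first by apply/prodf_neq0 => b _; case: (HP b).
move=> w; rewrite peval_prod => /prodf_neq0 Pw b.
by case: (HP b) => _; apply; exact: Pw.
Qed.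

End Selections.

(** * The error bound *)

Section ErrorBound.
Variables (R : realType) (n : nat).

Lemma common_positive (I : finType) (c : I -> R) :
  (forall i, 0 < c i) -> exists2 c0, 0 < c0 & forall i, c0 <= c i.
Proof.
move=> cpos; exists (\big[Num.min/1]_i c i); last by move=> i; apply: bigmin_le_cond.
by apply: lt_bigmin.
Qed.

Lemma common_upper (I : finType) (r : I -> R) : exists r0, forall i, r i <= r0.
Proof.
exists (\sum_i `|r i|) => i; rewrite (bigD1 i) //= (le_trans (ler_norm _)) //.
by rewrite lerDl sumr_ge0.
Qed.

Lemma dist_ge0 (x : 'rV[R]_n) S : 0 <= dist x S.
Proof.
rewrite /dist; case: asboolP => // /eqP/set0P[y Sy].
apply: lb_le_inf; first by exists (enorm (x - y)), y.
by move=> _ [z _ <-]; exact: sqrtr_ge0.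
Qed.

Lemma dist_le_enorm (x y : 'rV[R]_n) (S : set 'rV[R]_n) :
  S y -> dist x S <= enorm (x - y).
Proof.
move=> Sy; rewrite /dist; case: asboolP => [S0|_]; first by rewrite S0 in Sy.
apply: ge_inf; last by exists y.
by exists 0 => _ [z _ <-]; exact: sqrtr_ge0.
Qed.

Lemma dist_le_affine (S : set 'rV[R]_n) :
  exists2 M, 0 < M & forall x, dist x S <= M * (1 + `|x|).
Proof.
have [S0|/eqP/set0P[y Sy]] := pselect (S = set0).
  exists 1 => // x; rewrite /dist; case: asboolP => // _.
  by rewrite mul1r lerDl.
exists (n%:R * (1 + `|y|) + 1) => [|x].
  by rewrite ltr_wpDl // mulr_ge0 // addr_ge0.
apply: le_trans (dist_le_enorm x Sy) _; apply: le_trans (enorm_le_norm _) _.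
apply: (@le_trans _ _ (n%:R * (1 + `|y|) * (1 + `|x|))); last first.
  by rewrite ler_wpM2r ?addr_ge0 // lerDl.
rewrite -mulrA ler_wpM2l //; apply: le_trans (ler_normB _ _) _.
have := normr_ge0 x; have := normr_ge0 y; nra.
Qed.

Variables f g : 'rV[R]_n -> 'rV[R]_n.

Definition selection (b : {ffun 'I_n -> bool}) (x : 'rV[R]_n) : 'rV[R]_n :=
  \row_i (if b i then f x 0 i else g x 0 i).

Lemma minmap_selection x : exists b, minmap f g x = selection b x.
Proof.
exists [ffun i => f x 0 i <= g x 0 i]; apply/rowP => i.
by rewrite !mxE ffunE; case: leP.
Qed.

Lemma minmap_eq0_SOL x : minmap f g x = 0 -> SOL f g x.
Proof.
move=> /rowP m0; have {}m0 i : Num.min (f x 0 i) (g x 0 i) = 0.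
  by have := m0 i; rewrite !mxE.
split=> [i|i|].
- by rewrite -(m0 i) ge_min lexx.
- by rewrite -(m0 i) ge_min lexx orbT.
rewrite /inner big1 // => i _; have := m0 i.
by case: leP => _ ->; rewrite ?mul0r ?mulr0.
Qed.

Hypothesis selection_growth : forall b (a : 'rV[R]_n), exists2 c : R, 0 < c &
  \forall x \near a, c * `|x - a| <= `|selection b x|.
Hypothesis selection_growth_infty : forall b, exists2 c : R, 0 < c &
  exists r : R, forall x : 'rV[R]_n, r <= `|x| -> c * `|x| <= `|selection b x|.
Hypothesis f_cont : forall i, continuous (fun x : 'rV[R]_n => f x 0 i).
Hypothesis g_cont : forall i, continuous (fun x : 'rV[R]_n => g x 0 i).

Lemma minmap_continuous : continuous (minmap f g).
Proof.
move=> a; apply: (@cvg_row _ _ (nbhs a) _ _ (minmap f g)) => i.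
rewrite mxE minr_absE; under eq_cvg do rewrite mxE minr_absE.
apply: cvgM; last exact: cvg_cst.
apply: cvgB; first by apply: cvgD; [exact: f_cont|exact: g_cont].
by apply: cvg_norm; apply: cvgB; [exact: f_cont|exact: g_cont].
Qed.

(** At a zero a of m the growth of all selections at a bounds dist(x, SOL), since a
    belongs to SOL.  Elsewhere |m| is bounded below near a by continuity, and
    dist(x, SOL) is bounded above. *)
Lemma local_error_bound (a : 'rV[R]_n) : exists2 c : R, 0 < c &
  \forall x \near a, c * dist x (SOL f g) <= `|minmap f g x|.
Proof.
have [m0|m0] := eqVneq (minmap f g a) 0.
  have /choice [c cP] : forall b, exists c : R, 0 < c /\
      \forall x \near a, c * `|x - a| <= `|selection b x|.
    by move=> b; have [c c0 cP] := selection_growth b a; exists c.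
  have [c0 c00 c0P] := common_positive (fun b => (cP b).1).
  exists (c0 / n.+1%:R); first by rewrite divr_gt0.
  have /filter_forall := fun b => (cP b).2.
  apply: filterS => x growth; have [b ->] := minmap_selection x.
  apply: le_trans (growth b); apply: (@le_trans _ _ (c0 * `|x - a|)); last first.
    by rewrite ler_wpM2r.
  rewrite -mulrA ler_wpM2l ?(ltW c00) // ler_pdivrMl //.
  apply: le_trans (dist_le_enorm x (minmap_eq0_SOL m0)) _.
  by apply: le_trans (enorm_le_norm _) _; rewrite ler_wpM2r // ler_nat.
have [M M0 MP] := dist_le_affine (SOL f g).
pose eps := `|minmap f g a| / 2.
have eps0 : 0 < eps by rewrite divr_gt0 // normr_gt0.
have near_m : \forall x \near a, eps <= `|minmap f g x|.
  have : minmap f g x @[x --> a] --> minmap f g a by exact: minmap_continuous.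
  move=> /cvgr_norm_ge; apply.
  by have := m0; rewrite /eps -normr_gt0; lra.
have near_a : \forall x \near a, `|a - x| <= 1.
  by apply/nbhs_ballP; exists 1 => //= y; rewrite -ball_normE => /ltW.
have A0 : 0 < M * (2 + `|a|) by rewrite mulr_gt0 // ltr_wpDr.
exists (eps / (M * (2 + `|a|))); first by rewrite divr_gt0.
apply: filterS2 near_m near_a => x mx xa; apply: le_trans mx.
rewrite mulrAC ler_pdivrMr // ler_wpM2l ?(ltW eps0) //.
apply: le_trans (MP x) _; rewrite ler_wpM2l ?(ltW M0) //.
have : `|x| <= `|a| + `|a - x|.
  by rewrite -{1}[x](subKr a) ler_normB.
lra.
Qed.

Lemma error_bound_at_infinity : exists2 c : R, 0 < c & exists r : R,
  forall x, r <= `|x| -> c * dist x (SOL f g) <= `|minmap f g x|.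
Proof.
have /choice [c /choice[r cP]] : forall b, exists c : R, exists r : R, 0 < c /\
    forall x, r <= `|x| -> c * `|x| <= `|selection b x|.
  by move=> b; have [c c0 [r]] := selection_growth_infty b; exists c, r.
have [c0 c00 c0P] := common_positive (fun b => (cP b).1).
have [r0 r0P] := common_upper r.
have [M M0 MP] := dist_le_affine (SOL f g).
exists (c0 / (2 * M)); first by rewrite divr_gt0 // mulr_gt0.
exists (Num.max 1 r0) => x; rewrite ge_max => /andP[x1 xr0].
have [b ->] := minmap_selection x.
apply: le_trans ((cP b).2 x (le_trans (r0P b) xr0)).
apply: (@le_trans _ _ (c0 * `|x|)); last by rewrite ler_wpM2r.
rewrite -mulrA ler_wpM2l ?(ltW c00) // ler_pdivrMl ?mulr_gt0 //.
by apply: le_trans (MP x) _; nra.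
Qed.

(** A bound with constant c implies the bound with any smaller positive constant,
    so the local bounds hold for all c close to 0 on the right, which is the
    form in which compactness of the ball makes them uniform. *)
Lemma global_error_bound : exists2 c : R, 0 < c &
  forall x, c * dist x (SOL f g) <= enorm (minmap f g x).
Proof.
have [c1 c10 [r c1P]] := error_bound_at_infinity.
have : \forall c \near (0 : R)^'+, [set x : 'rV[R]_n | `|x| <= r] `<=`
    (fun x => c * dist x (SOL f g) <= `|minmap f g x|).
  apply: ((compact_near_coveringP _).1 (@compact_closed_norm_ball R n r) R _
    (fun c x => c * dist x (SOL f g) <= `|minmap f g x|)) => a _.
  have [c c0 ca] := local_error_bound a.
  exists ([set x | c * dist x (SOL f g) <= `|minmap f g x|], [set t | t <= c]).
    by split => //=; exact: nbhs_right_le.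
  move=> [x t] /= [xc tc]; apply: le_trans xc.
  by rewrite ler_wpM2r // dist_ge0.
move=> ball_bound.
have [c [[c0 cc1] cP]] := filter_ex (filterI (filterI (nbhs_right_gt (0 : R))
  (nbhs_right_le c10)) ball_bound).
exists c => // x; apply: le_trans (norm_le_enorm _).
have [xr|rx] := leP `|x| r; first exact: cP.
by apply: le_trans (c1P x (ltW rx)); rewrite ler_wpM2r // dist_ge0.
Qed.

End ErrorBound.

Theorem proposition5p1 (R : realType) (n : nat) (d d' : 'I_n -> nat)
    (n_gt0 : (0 < n)%N)
    (d_gt0 : forall i, (0 < d i)%N) (d'_gt0 : forall i, (0 < d' i)%N) :
  exists U : set (polymaps R d * polymaps R d'),
    [/\ open U, dense U, semialgebraic2 U
      & forall u, U u ->
        let f := pmap_eval u.1 in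
        let g := pmap_eval u.2 in
        exists2 c : R, 0 < c &
          forall x : 'rV[R]_n, c * dist x (SOL f g) <= enorm (minmap f g x)].
Proof.
have [P P0 generic] := exists_generic_poly R d_gt0 d'_gt0.
exists (nonroots P); split.
- exact: open_nonroots.
- exact: dense_nonroots.
- exact: semialgebraic_nonroots.
move=> u Uu f g; have {}generic := generic _ Uu.
have selE b x : selection f g b x =
    \row_i peval (gensys (@sel_pos n d d' b) (row_mx u.1 u.2) i) x.
  by apply/rowP => i; rewrite !mxE gensys_sel; case: (b i).
have evalC (e : 'I_n -> nat) (v : polymaps R e) i :
    continuous (fun x => pmap_eval v x 0 i).
  move=> x; rewrite /continuous_at mxE; under eq_cvg do rewrite mxE.
  exact: continuous_peval.
apply: global_error_bound => [b a|b|i|i].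
- have [c c0 cP] := regular_growth (generic b).1 a; exists c => //.
  by apply: filterS cP => x; rewrite selE.
- have e0 i : (0 < sel_deg d d' b i)%N by rewrite /sel_deg; case: (b i).
  have [c c0 [r cP]] := gensys_growth e0 (generic b).2; exists c => //.
  by exists r => x /cP; rewrite selE.
- exact: evalC.
- exact: evalC.
Qed.
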